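(* Let $a,b\in[1/2,1]$ be any numbers satisfying $2b+a=2$. For every $\epsilon>0$ there exists a quantum protocol for weak oblivious transfer with $P^{\star}_{\mathrm{Alice}} \leq a+\epsilon/2$ and $P^{\star}_{\mathrm{Bob}}\leq b+\epsilon/4$, so that $2P^{\star}_{\mathrm{Bob}}+P^{\star}_{\mathrm{Alice}}\leq 2+\epsilon$.
   Context: Oblivious transfer is a two-party task in which Alice has a choice bit $a\in\{0,1\}$ and Bob has two data bits $x_0,x_1\in\{0,1\}$. A quantum protocol for oblivious transfer is an interactive quantum protocol between Alice and Bob that is complete: if both parties follow it honestly, neither party aborts and at the end Alice learns $x_a$ with certainty. Honest parties' inputs are taken uniformly at random. For a given protocol, $P^{\star}_{\mathrm{Bob}}$ denotes the maximum, over all cheating strategies of Bob, of the probability that Bob correctly guesses honest Alice's uniformly random choice bit and honest Alice does not abort. $P^{\star}_{\mathrm{Alice}}$ denotes the maximum over the choice index $c\in\{0,1\}$ of the maximum, over all cheating strategies of Alice that let her guess $x_c$ with certainty, of the probability that she correctly guesses $x_{1-c}$ and honest Bob (with uniformly random $x_0,x_1$) does not abort. ''Weak oblivious transfer'' refers to this definition of $P^{\star}_{\mathrm{Alice}}$. *)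

(* Defs.v *)
(* scalars are the complex numbers R[i] over an arbitrary
   realType R (all realTypes are isomorphic to the real numbers). *)
From HB Require Import structures.
From mathcomp Require Import all_boot all_algebra.
From mathcomp Require Import reals.
From mathcomp.real_closed Require Import complex.

Unset Printing Implicit Defensive.

Import GRing.Theory Num.Theory.
Local Open Scope ring_scope.

(* Finite-dimensional quantum mechanics, with Hilbert spaces C^I for a      *)
(* finite index type I (composite systems use product index types).         *)
Section Quantum.
Variable R : realType.
Local Notation C := (R[i]).

Definition qvec (I : finType) := I -> C.
Definition qop (I : finType) := I -> I -> C.

Definition qapply {I : finType} (U : qop I) (v : qvec I) : qvec I :=
  fun i => \sum_(j : I) U i j * v j.

Definition qform {I : finType} (v : qvec I) (E : qop I) (w : qvec I) : C :=
  \sum_(i : I) \sum_(j : I) conjc (v i) * E i j * w j.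

Definition qnormalized {I : finType} (v : qvec I) : Prop :=
  \sum_(i : I) conjc (v i) * v i = 1.

(* unitary: U^dagger U = Id (equivalent to unitarity in finite dimension) *)
Definition qunitary {I : finType} (U : qop I) : Prop :=
  forall i j : I, \sum_(k : I) conjc (U k i) * U k j = (i == j)%:R.

Definition qpsd {I : finType} (E : qop I) : Prop :=
  forall v : qvec I, 0 <= qform v E v.

Definition qpovm {O I : finType} (E : O -> qop I) : Prop :=
  (forall o, qpsd (E o)) /\
  (forall i j : I, \sum_(o : O) E o i j = (i == j)%:R).

(* Two-party interactive protocols.  The global space is (A * M) * B where  *)
(* A is Alice's private register, M the message register and B Bob's        *)
(* private register.  Round r (r < n) consists of Alice applying a unitary  *)
(* on A*M, sending M to Bob, then Bob applying a unitary on M*B and sending *)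
(* M back to Alice.  At the end Alice measures A*M and Bob measures B.      *)
Section Run.
Context {A M B : finType}.

Definition liftA (U : qop (A * M)%type) : qop ((A * M) * B)%type :=
  fun i j => U i.1 j.1 * (i.2 == j.2)%:R.

Definition liftB (V : qop (M * B)%type) : qop ((A * M) * B)%type :=
  fun i j => V (i.1.2, i.2) (j.1.2, j.2) * (i.1.1 == j.1.1)%:R.

Definition qprod (psi : qvec (A * M)%type) (phi : qvec B) : qvec ((A * M) * B)%type :=
  fun i => psi i.1 * phi i.2.

Fixpoint qrun (UA : nat -> qop (A * M)%type) (UB : nat -> qop (M * B)%type)
    (s : qvec ((A * M) * B)%type) (n : nat) : qvec ((A * M) * B)%type :=
  match n with
  | 0 => s
  | n'.+1 => qapply (liftB (UB n')) (qapply (liftA (UA n')) (qrun UA UB s n'))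
  end.

Definition qjoint (E : qop (A * M)%type) (F : qop B) (s : qvec ((A * M) * B)%type) : C :=
  qform s (fun i j => E i.1 j.1 * F i.2 j.2) s.

End Run.

(* Oblivious transfer protocols (in purified form).                         *)
(* Alice's input a : bool is her choice bit; Bob's inputs are x0 x1 : bool.*)
(* The inputs are encoded in the initial states.  Alice's final measurement *)
(* has outcomes  None (abort) / Some y (accept and output y as x_a);        *)
(* Bob's final measurement has outcomes true (accept) / false (abort).      *)
Record ot_protocol := OTProtocol {
  dA : nat; dM : nat; dB : nat;
  nrounds : nat;
  initA : bool -> qvec ('I_dA * 'I_dM)%type;
  initB : bool -> bool -> qvec 'I_dB;
  UA : nat -> qop ('I_dA * 'I_dM)%type;
  UB : nat -> qop ('I_dM * 'I_dB)%type;
  outA : option bool -> qop ('I_dA * 'I_dM)%type;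
  outB : bool -> qop 'I_dB
}.


Definition sel (c x0 x1 : bool) : bool := if c then x1 else x0.

Definition ot_wellformed (P : ot_protocol) : Prop :=
  (forall a, qnormalized (initA P a)) /\
  (forall x0 x1, qnormalized (initB P x0 x1)) /\
  (forall r, (r < nrounds P)%N -> qunitary (UA P r)) /\
  (forall r, (r < nrounds P)%N -> qunitary (UB P r)) /\
  qpovm (outA P) /\ qpovm (outB P).

Definition honest_state (P : ot_protocol) (a x0 x1 : bool) :=
  qrun (UA P) (UB P) (qprod (initA P a) (initB P x0 x1)) (nrounds P).

Definition ot_complete (P : ot_protocol) : Prop :=
  forall a x0 x1 : bool,
    qjoint (outA P (Some (sel a x0 x1))) (outB P true) (honest_state P a x0 x1) = 1.

Definition ot_protocol_ok (P : ot_protocol) : Prop :=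
  ot_wellformed P /\ ot_complete P.

Record bob_strategy (P : ot_protocol) := BobStrategy {
  bk : nat;
  binit : qvec 'I_bk;
  bU : nat -> qop ('I_(dM P) * 'I_bk)%type;
  bguess : bool -> qop 'I_bk
}.


Arguments bk {P}.
Arguments binit {P}.
Arguments bU {P}.
Arguments bguess {P}.

Definition bob_strategy_ok {P} (S : bob_strategy P) : Prop :=
  qnormalized (binit S) /\
  (forall r, (r < nrounds P)%N -> qunitary (bU S r)) /\
  qpovm (bguess S).

Definition bob_success {P} (S : bob_strategy P) : C :=
  2%:R^-1 * \sum_(a : bool) \sum_(y : bool)
    qjoint (outA P (Some y)) (bguess S a)
      (qrun (UA P) (bU S) (qprod (initA P a) (binit S)) (nrounds P)).

(* A cheating Alice: arbitrary private register 'I_k (replacing 'I_dA),   *)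
(* pure initial state on 'I_k * M, unitaries on 'I_k * M, final POVM on    *)
(* 'I_k * M with outcome (g0, g1) = her guesses for (x0, x1).              *)
Record alice_strategy (P : ot_protocol) := AliceStrategy {
  ak : nat;
  ainit : qvec ('I_ak * 'I_(dM P))%type;
  aU : nat -> qop ('I_ak * 'I_(dM P))%type;
  aguess : (bool * bool)%type -> qop ('I_ak * 'I_(dM P))%type
}.


Arguments ak {P}.
Arguments ainit {P}.
Arguments aU {P}.
Arguments aguess {P}.

Definition alice_strategy_ok {P} (S : alice_strategy P) : Prop :=
  qnormalized (ainit S) /\
  (forall r, (r < nrounds P)%N -> qunitary (aU S r)) /\
  qpovm (aguess S).

Definition alice_state {P} (S : alice_strategy P) (x0 x1 : bool) :=
  qrun (aU S) (UB P) (qprod (ainit S) (initB P x0 x1)) (nrounds P).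

Definition alice_certain {P} (S : alice_strategy P) (c : bool) : Prop :=
  forall x0 x1 : bool,
    \sum_(g : bool * bool | sel c g.1 g.2 == sel c x0 x1) \sum_(acc : bool)
      qjoint (aguess S g) (outB P acc) (alice_state S x0 x1) = 1.

Definition alice_success {P} (S : alice_strategy P) (c : bool) : C :=
  4%:R^-1 * \sum_(x0 : bool) \sum_(x1 : bool)
    \sum_(g : bool * bool | sel (~~ c) g.1 g.2 == sel (~~ c) x0 x1)
      qjoint (aguess S g) (outB P true) (alice_state S x0 x1).

Definition PBob_le (P : ot_protocol) (p : R) : Prop :=
  forall S : bob_strategy P, bob_strategy_ok S -> bob_success S <= (p%:C)%C.

Definition PAlice_le (P : ot_protocol) (p : R) : Prop :=
  forall (c : bool) (S : alice_strategy P),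
    alice_strategy_ok S -> alice_certain S c -> alice_success S c <= (p%:C)%C.

End Quantum.

Arguments ot_protocol_ok {R}.
Arguments PAlice_le {R}.
Arguments PBob_le {R}.

(* Main.v *)
(** Honest Alice with choice bit [a] sends half of the entangled state
    [sum_m sqrt (w^a_m) |m>|m>], where [m] ranges over the basis states [a] and [2] (each of
    weight [(1 - p) / 2]) and over two "full" states of total weight [p].  Bob puts the phase
    [(-1)^(x_c)] on [|c>] and answers a full message with both bits, up to a random relative
    sign that makes the two blocks incoherent.  Bob's view for [a = 0] and for [a = 1] differs only
    in the messages [0] and [1], so he guesses [a] with probability at most [(3 - p) / 4].

    A cheating Alice would send only full messages.  No coin flipping is needed to prevent
    this, because she must learn [x_c] with certainty: with a small probability [delta] Bob
    runs a test, which discloses the other bit and encodes [x_c] in phases [z_m^(x_c)] with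
    [Re z_m = p - [m is full]].  The two test states are orthogonal only if the weights [w]
    of her messages satisfy [sum_m w_m z_m = 0], whose real part says that the full weight is
    exactly [p].  The untested branch likewise forces the weight of the message [1 - c] to be
    [0], so she guesses [x_(1-c)] with probability at most [(1 + p) / 2 + delta].
    Finally take [p = 2 a - 1]. *)
Require Import Defs.
From HB Require Import structures.
From mathcomp Require Import all_boot all_order all_algebra.
From mathcomp Require Import reals.
From mathcomp.real_closed Require Import complex.
From mathcomp Require Import ring lra.
Import Order.TTheory GRing.Theory Num.Theory.
Local Open Scope ring_scope.
Local Notation "x ^*" := (conjc x) : ring_scope.
Local Notation "x %:C" := (real_complex _ x) : ring_scope.
Local Notation Re := complex.Re.
Local Notation Im := complex.Im.
(* Otherwise [/=] unfolds the operations of [R[i]] into real and imaginary parts. *)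
#[local] Arguments GRing.mul : simpl never.
#[local] Arguments Algebra.add : simpl never.
#[local] Arguments Algebra.opp : simpl never.
#[local] Arguments conjc : simpl never.

Arguments qapply {R I} U v.
Arguments qform {R I} v E w.
Arguments qnormalized {R I} v.
Arguments qunitary {R I} U.
Arguments qpsd {R I} E.
Arguments qpovm {R O I} E.
Arguments liftA {R A M B} U.
Arguments liftB {R A M B} V.
Arguments qprod {R A M B} psi phi.
Arguments qjoint {R A M B} E F s.

(** * Inner products and measurements *)

Section Conjugation.
Context {R : rcfType}.
Implicit Types x y : R[i].

Lemma conjcD x y : (x + y)^* = x^* + y^*. Proof. exact: rmorphD. Qed.
Lemma conjcN x : (- x)^* = - x^*. Proof. exact: rmorphN. Qed.
Lemma conjcM x y : (x * y)^* = x^* * y^*. Proof. exact: rmorphM. Qed.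
Lemma conjc_sum (I : Type) (r : seq I) (P : pred I) (F : I -> R[i]) :
  (\sum_(i <- r | P i) F i)^* = \sum_(i <- r | P i) (F i)^*.
Proof. exact: rmorph_sum. Qed.

End Conjugation.

Section InnerProduct.
Context {R : realType} {I : finType}.
Implicit Types (u v w : qvec R I) (E U : qop R I).

Definition qdot v w : R[i] := \sum_i (v i)^* * w i.

Lemma qdot_ge0 v : 0 <= qdot v v.
Proof. by apply: sumr_ge0 => i _; rewrite mulrC mulcJ_ge0. Qed.

Lemma qdot_eq0 v : qdot v v = 0 -> forall i, v i = 0.
Proof.
move=> /eqP; rewrite psumr_eq0 => [/allP h i|i _]; last by rewrite mulrC mulcJ_ge0.
by have := h i (mem_index_enum i); rewrite mulf_eq0 conjc_eq0 orbb => /eqP.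
Qed.

Lemma conj_qdot v w : (qdot v w)^* = qdot w v.
Proof.
rewrite /qdot conjc_sum; apply: eq_bigr => i _.
by rewrite conjcM conjcK mulrC.
Qed.

Lemma eq_qdot v v' w w' : v =1 v' -> w =1 w' -> qdot v w = qdot v' w'.
Proof. by move=> hv hw; apply: eq_bigr => i _; rewrite hv hw. Qed.

Lemma qdotDr v w w' c : qdot v (fun i => w i + c * w' i) = qdot v w + c * qdot v w'.
Proof.
rewrite /qdot mulr_sumr -big_split; apply: eq_bigr => i _ /=.
by rewrite mulrDr mulrCA.
Qed.

Lemma qdotDl v w w' c : qdot (fun i => w i + c * w' i) v = qdot w v + c^* * qdot w' v.
Proof. by rewrite -conj_qdot qdotDr conjcD conjcM !conj_qdot. Qed.

Lemma qdot0r v w : w =1 (fun=> 0) -> qdot v w = 0.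
Proof. by move=> w0; rewrite /qdot big1// => i _; rewrite w0 mulr0. Qed.

Lemma qform_dot v E w : qform v E w = qdot v (qapply E w).
Proof.
by apply: eq_bigr => i _; rewrite mulr_sumr; apply: eq_bigr => j _; rewrite mulrA.
Qed.

Lemma eq_qform v v' E w w' : v =1 v' -> w =1 w' -> qform v E w = qform v' E w'.
Proof.
by move=> hv hw; apply: eq_bigr => i _; apply: eq_bigr => j _; rewrite hv hw.
Qed.

Lemma qapplyD E v w c :
  qapply E (fun i => v i + c * w i) =1 (fun i => qapply E v i + c * qapply E w i).
Proof.
move=> i; rewrite /qapply mulr_sumr -big_split; apply: eq_bigr => j _ /=.
by rewrite mulrDr mulrCA.
Qed.

Lemma eq_qapply E v v' : v =1 v' -> qapply E v =1 qapply E v'.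
Proof. by move=> h i; apply: eq_bigr => j _; rewrite h. Qed.

Lemma qformDr v E w w' c :
  qform v E (fun i => w i + c * w' i) = qform v E w + c * qform v E w'.
Proof.
by rewrite !qform_dot -qdotDr; apply: eq_qdot => // i; rewrite qapplyD.
Qed.

Lemma qformDl v E w w' c :
  qform (fun i => w i + c * w' i) E v = qform w E v + c^* * qform w' E v.
Proof. by rewrite !qform_dot qdotDl. Qed.

(** The cross terms cancel: averaging over a random relative sign makes the two components
    incoherent. *)
Lemma qform_parallelogram E v w :
  qform (fun i => v i + 1 * w i) E (fun i => v i + 1 * w i) +
  qform (fun i => v i + (-1) * w i) E (fun i => v i + (-1) * w i) =
  2 * (qform v E v + qform w E w).
Proof. by rewrite !(qformDl, qformDr) conjcN conjc1; ring. Qed.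

Lemma qform_sum {O : finType} (P : pred O) (E : O -> qop R I) v w :
  qform v (fun i j => \sum_(o | P o) E o i j) w = \sum_(o | P o) qform v (E o) w.
Proof.
rewrite /qform [RHS]exchange_big; apply: eq_bigr => i _ /=.
rewrite [RHS]exchange_big; apply: eq_bigr => j _ /=.
by rewrite mulr_sumr mulr_suml.
Qed.

Lemma qform_id E v w : (forall i j, E i j = (i == j)%:R) -> qform v E w = qdot v w.
Proof.
move=> hE; apply: eq_bigr => i _; rewrite (bigD1 i)//= big1 ?addr0.
  by rewrite hE eqxx mulr1.
by move=> j ji; rewrite hE eq_sym (negPf ji) mulr0 mul0r.
Qed.

Lemma qunitary_dot U v w : qunitary U -> qdot (qapply U v) (qapply U w) = qdot v w.
Proof.
move=> hU; rewrite -[RHS](qform_id (fun i j => (i == j)%:R))// /qdot /qapply.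
transitivity (\sum_k \sum_i \sum_j ((v i)^* * ((U k i)^* * U k j) * w j)).
  apply: eq_bigr => k _ /=; rewrite conjc_sum mulr_suml; apply: eq_bigr => i _.
  by rewrite mulr_sumr; apply: eq_bigr => j _; rewrite conjcM; ring.
rewrite exchange_big; apply: eq_bigr => i _ /=.
rewrite exchange_big; apply: eq_bigr => j _ /=.
by rewrite -mulr_suml -mulr_sumr hU.
Qed.

Lemma qpovm_dot {O : finType} (E : O -> qop R I) v w :
  qpovm E -> \sum_o qform v (E o) w = qdot v w.
Proof. by case=> _ hE; rewrite -qform_sum; apply: qform_id. Qed.

Lemma qpovm_le1 {O : finType} (E : O -> qop R I) (P : pred O) v :
  qpovm E -> \sum_(o | P o) qform v (E o) v <= qdot v v.
Proof.
move=> hE; rewrite -(qpovm_dot E v v hE) [leRHS](bigID P)/= lerDl.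
by apply: sumr_ge0 => o _; apply: hE.1.
Qed.

(* [<u + t v|E|u + t v> >= 0] is affine in [t] for [t] real and for [t] imaginary,
   hence constant. *)
Lemma qpsd_null E u v : qpsd E -> qform v E v = 0 -> qform u E v = 0 /\ qform v E u = 0.
Proof.
move=> hE hv.
have H t : 0 <= qform u E u + (t * qform u E v + t^* * qform v E u).
  have := hE (fun i => u i + t * v i).
  by rewrite !(qformDl, qformDr) hv !(mulr0, addr0) addrA.
set X := qform u E v in H *; set Y := qform v E u in H *; set A := qform u E u in H.
have aff (z : R[i]) : (forall r : R, 0 <= A + r%:C * z) -> z = 0.
  move=> hz; have hA : 0 <= A by have := hz 0; rewrite mul0r addr0.
  have hr r : Im (r%:C * z) = 0 /\ 0 <= Re A + r * Re z.
    have := hz r; have := hA; case: (A) => a a'; case: (z) => x y; rewrite !lecE/=.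
    by move=> /andP[/eqP -> _] /andP[/eqP]; rewrite !mul0r subr0 !add0r addr0 => ->.
  have imz : Im z = 0.
    by have [] := hr 1; case: (z) => x y /=; rewrite !mul1r mul0r addr0.
  suff rez : Re z = 0 by move: imz rez; case: (z) => x y /= -> ->.
  apply/eqP; apply/negPn/negP => z0.
  (* This [r] brings the real part down to -1. *)
  have [_] := hr (- (Re A + 1) / Re z); rewrite mulfVK//; lra.
have s1 : X + Y = 0.
  by apply: aff => r; have := H r%:C; rewrite conjc_real mulrDr.
have s2 : 'i%C * (X - Y) = 0.
  have conji : ('i%C)^* = - 'i%C :> R[i] by rewrite -[RHS]/(- 0 -i* 1)%C oppr0.
  apply: aff => r; have := H (r%:C * 'i%C); rewrite conjcM conjc_real conji.
  by congr (0 <= _ + _); ring.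
have {}s2 : X - Y = 0.
  by move/eqP: s2; rewrite mulf_eq0 eq_complex/= oner_eq0 andbF => /eqP.
have X0 : X = 0.
  have : 2 * X = 0 by rewrite -[RHS](addr0 0) -{1}s1 -s2; ring.
  by move/eqP; rewrite mulf_eq0 pnatr_eq0/= => /eqP.
by split=> //; move: s1; rewrite X0 add0r.
Qed.

(** Every outcome has probability 0 on [v] or on [w], so by [qpsd_null] each cross term
    [qform v (E o) w] vanishes; these terms add up to the inner product. Thus states that a
    measurement separates with certainty are orthogonal. *)
Lemma qpovm_certain {O : finType} (E : O -> qop R I) (P : pred O) v w :
  qpovm E ->
  \sum_(o | P o) qform v (E o) v = qdot v v ->
  \sum_(o | ~~ P o) qform w (E o) w = qdot w w ->
  qdot v w = 0.
Proof.
move=> hE hv hw; have [psdE _] := hE.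
have null (Q : pred O) x : \sum_(o | Q o) qform x (E o) x = qdot x x ->
    forall o, ~~ Q o -> qform x (E o) x = 0.
  rewrite -(qpovm_dot E x x hE) [X in _ = X -> _](bigID Q)/= -[X in X = _]addr0.
  move=> /addrI/esym/eqP; rewrite psumr_eq0 => [/allP h o Qo|o _]; last exact: psdE.
  by have := h o (mem_index_enum o); rewrite Qo => /eqP.
rewrite -(qpovm_dot E v w hE) big1// => o _.
case/boolP: (P o) => Po.
  by have [] := qpsd_null (E o) v w (psdE o) (null _ _ hw o _); rewrite // negbK.
by have [] := qpsd_null (E o) w v (psdE o) (null _ _ hv o Po).
Qed.

End InnerProduct.

(** * Perfect discrimination of orthogonal families *)

Section Discrimination.
Context {R : realType} {I : finType}.
Implicit Types (u v w : qvec R I) (E : qop R I).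

(* Gram-Schmidt: each step adds [|w><w| / <w|w>] for the residue [w] of a new vector. *)
Lemma span_projector {J : eqType} (u : J -> qvec R I) (s : seq J) :
  exists E : qop R I,
    [/\ forall v w, qdot (qapply E v) w = qdot v (qapply E w),
        forall v, qapply E (qapply E v) =1 qapply E v,
        forall j, j \in s -> qapply E (u j) =1 u j &
        forall v, (forall j, j \in s -> qdot (u j) v = 0) -> qapply E v =1 (fun=> 0)].
Proof.
elim: s => [|j s [E [herm idem fix_s ker_s]]].
  have E0 v : qapply (fun _ _ => 0 : R[i]) v =1 (fun=> 0 : R[i]).
    by move=> i; rewrite /qapply big1// => k _; rewrite mul0r.
  exists (fun _ _ => 0); split=> // v.
  - by move=> w; rewrite [RHS]qdot0r// -conj_qdot qdot0r ?conjc0.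
  - by move=> i; rewrite !E0.
pose w : qvec R I := fun i => u j i + (-1) * qapply E (u j) i.
have Ew : qapply E w =1 (fun=> 0).
  by move=> i; rewrite qapplyD idem mulN1r subrr.
(* A zero residue means that [u j] already lies in the range of [E], so [E] is kept. *)
have [w0|nz] := eqVneq (qdot w w) 0.
  have fix_j : qapply E (u j) =1 u j.
    move=> i; have /eqP := qdot_eq0 w w0 i.
    by rewrite /w mulN1r subr_eq0 eq_sym => /eqP.
  exists E; split=> // [k|v hv]; first by rewrite inE => /predU1P[->|/fix_s].
  by apply: ker_s => k ks; apply: hv; rewrite inE ks orbT.
pose n := (qdot w w)^-1.
have nJ : n^* = n by rewrite /n conjc_inv conj_qdot.
pose E' : qop R I := fun i k => E i k + n * (w i * (w k)^*).
have E'E v : qapply E' v =1 (fun i => qapply E v i + (n * qdot w v) * w i).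
  move=> i; rewrite /qapply /qdot mulr_sumr mulr_suml -big_split.
  by apply: eq_bigr => k _ /=; rewrite /E'; ring.
have wE v : qdot w (qapply E v) = 0.
  by rewrite -herm -conj_qdot qdot0r ?conjc0.
exists E'; split.
- move=> v v'; rewrite (eq_qdot _ _ _ _ (E'E v) (frefl v')).
  rewrite (eq_qdot _ _ _ _ (frefl v) (E'E v')) qdotDl qdotDr herm.
  by rewrite conjcM nJ conj_qdot; ring.
- move=> v i; rewrite !E'E (eq_qapply _ _ _ (E'E v)) qapplyD idem Ew mulr0 addr0.
  rewrite (eq_qdot _ _ _ _ (frefl w) (E'E v)) qdotDr wE add0r.
  by rewrite mulrCA -/n (_ : n * qdot w w = 1) ?mulr1 // mulVf.
- have wu : qdot w (u j) = qdot w w by rewrite [RHS]qdotDr wE mulr0 addr0.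
  move=> k; rewrite inE => /predU1P[->|ks] i; rewrite E'E.
    by rewrite wu mulVf// mul1r /w mulN1r addrC subrK.
  rewrite fix_s// (_ : qdot w (u k) = 0) ?mulr0 ?mul0r ?addr0//.
  by rewrite -(wE (u k)); apply: eq_qdot => // i'; rewrite fix_s.
- move=> v hv i; rewrite E'E ker_s ?add0r => [|k ks]; last first.
    by apply: hv; rewrite inE ks orbT.
  have Ev : qapply E v =1 (fun=> 0).
    by apply: ker_s => k ks; apply: hv; rewrite inE ks orbT.
  rewrite /w qdotDl hv ?inE ?eqxx// herm (qdot0r _ _ Ev).
  by rewrite !(mulr0, addr0, mul0r).
Qed.

(** Measure the projector onto the span of the vectors labelled [true] against its complement. No
    orthogonality within a label is required. *)
Lemma perfect_discrimination {J : finType} (u : J -> qvec R I) (lab : J -> bool) :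
  (forall j k, lab j != lab k -> qdot (u j) (u k) = 0) ->
  exists E : bool -> qop R I,
    qpovm E /\ forall j, qform (u j) (E (lab j)) (u j) = qdot (u j) (u j).
Proof.
move=> orth.
have [E [herm idem fixE kerE]] := span_projector u (filter lab (enum J)).
pose F : qop R I := fun i k => (i == k)%:R + (-1) * E i k.
have FE v : qapply F v =1 (fun i => v i + (-1) * qapply E v i).
  move=> i; rewrite /qapply mulr_sumr.
  rewrite [X in X + _](_ : v i = \sum_k (i == k)%:R * v k); last first.
    rewrite (bigD1 i)//= eqxx mul1r big1 ?addr0// => k.
    by rewrite eq_sym => /negPf ->; rewrite mul0r.
  by rewrite -big_split; apply: eq_bigr => k _ /=; rewrite /F; ring.
have formE v : qform v E v = qdot (qapply E v) (qapply E v).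
  by rewrite qform_dot herm; apply: eq_qdot => // i; rewrite idem.
have formF v : qform v F v = qdot v v - qform v E v.
  rewrite !qform_dot (eq_qdot _ _ _ _ (frefl v) (FE v)) qdotDr; ring.
have formF' v : qform v F v = qdot (qapply F v) (qapply F v).
  rewrite formF !(eq_qdot _ _ _ _ (FE v) (FE v)) qdotDl !qdotDr.
  by rewrite conjcN conjc1 -formE !qform_dot (herm v v); ring.
exists (fun b => if b then E else F); split.
  split=> [[] v|i k].
  - by rewrite formE qdot_ge0.
  - by rewrite formF' qdot_ge0.
  - by rewrite big_bool /= /F; ring.
move=> j; have memJ k : (k \in filter lab (enum J)) = lab k.
  by rewrite mem_filter mem_enum andbT.
case: ifPn => [labj|labj].
  by rewrite qform_dot; apply: eq_qdot => // i; rewrite fixE ?memJ.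
rewrite formF qform_dot (qdot0r _ (qapply E (u j))) ?subr0//.
by apply: kerE => k; rewrite memJ => labk; apply: orth; rewrite labk (negPf labj).
Qed.

End Discrimination.

(** * One-round protocols *)

Section OneRound.
Context {R : realType} {A M B : finType}.
Implicit Types (psi phi : qvec R (A * M)%type) (beta : qvec R B) (b : B).

Lemma sum_pair {I J : finType} (F : I * J -> R[i]) :
  \sum_p F p = \sum_i \sum_j F (i, j).
Proof. by rewrite pair_bigA; apply: eq_bigr => -[]. Qed.

Lemma sum_natb {I : finType} (k : I) (F : I -> R[i]) :
  \sum_i (i == k)%:R * F i = F k.
Proof.
rewrite (bigD1 k)//= eqxx mul1r big1 ?addr0// => i /negPf ->.
by rewrite mul0r.
Qed.

Lemma sum_natb_const {I : finType} (k : I) (x : R[i]) :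
  \sum_i (i == k)%:R * x = x.
Proof. exact: (sum_natb k (fun=> x)). Qed.

Definition qid {I : finType} : qop R I := fun i j => (i == j)%:R.

Lemma qapply_id {I : finType} (v : qvec R I) : qapply qid v =1 v.
Proof.
by move=> i; rewrite -[RHS](sum_natb i v); apply: eq_bigr => j _; rewrite /qid eq_sym.
Qed.

Lemma qunitary_id {I : finType} : qunitary (@qid I).
Proof.
move=> i j; rewrite -[RHS](sum_natb i (fun i => (i == j)%:R)).
by apply: eq_bigr => k _; rewrite /qid conjc_nat.
Qed.

Lemma qapply_liftA (U : qop R (A * M)%type) psi beta :
  qapply (liftA U) (qprod psi beta) =1 qprod (qapply U psi) beta.
Proof.
move=> [x b]; rewrite /qapply sum_pair /qprod mulr_suml; apply: eq_bigr => y _ /=.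
rewrite -[RHS](sum_natb b (fun b => U x y * psi y * beta b)).
by apply: eq_bigr => c _; rewrite /liftA/= eq_sym; ring.
Qed.

Lemma qapply_liftB (V : qop R (M * B)%type) (s : qvec R (A * M * B)%type) x m b :
  qapply (liftB V) s (x, m, b) = qapply V (fun j => s (x, j.1, j.2)) (m, b).
Proof.
rewrite /qapply 3!sum_pair.
rewrite -[RHS](sum_natb x (fun x => \sum_m' \sum_b' V (m, b) (m', b') * s (x, m', b'))).
apply: eq_bigr => y _; rewrite mulr_sumr; apply: eq_bigr => m' _.
by rewrite mulr_sumr; apply: eq_bigr => b' _; rewrite /liftB/= eq_sym; ring.
Qed.

Section Controlled.
Variables (ph : B -> M -> R[i]) (act : B -> M -> M).

(* On the basis state [b] of Bob, the message [act b m] becomes [m] with phase [ph b m]. *)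
Definition controlled : qop R (M * B)%type :=
  fun i j => (j == (act i.2 i.1, i.2))%:R * ph i.2 i.1.

(** The state of Alice and the message once Bob, in basis state [b], has acted. As [act b] is an
    involution, pulling back along it is the same as pushing forward. *)
Definition twist {A' : finType} b (phi : qvec R (A' * M)%type) : qvec R (A' * M)%type :=
  fun i => ph b i.2 * phi (i.1, act b i.2).

Hypothesis (ph_norm : forall b m, (ph b m)^* * ph b m = 1).
Hypothesis (actK : forall b, involutive (act b)).

Lemma qunitary_controlled : qunitary controlled.
Proof.
move=> [m b] [m' b'].
transitivity (\sum_k (k == (act b m, b))%:R * ((m, b) == (m', b'))%:R : R[i]); last first.
  exact: sum_natb_const.
apply: eq_bigr => -[m1 b1] _; rewrite /controlled/= conjcM conjc_nat.
have -> : ((m, b) == (act b1 m1, b1)) = ((m1, b1) == (act b m, b)).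
  by apply/eqP/eqP => -[-> ->]; rewrite actK.
case: eqP => [[-> ->]|]; last by rewrite !mul0r.
by rewrite actK [(m', b') == _]eq_sym !mul1r mulrCA ph_norm mulr1.
Qed.

Lemma dot_twist {A' : finType} b (phi : qvec R (A' * M)%type) :
  qdot (twist b phi) (twist b phi) = qdot phi phi.
Proof.
rewrite /qdot !sum_pair; apply: eq_bigr => x _.
rewrite [RHS](reindex_inj (inv_inj (actK b))); apply: eq_bigr => m _ /=.
by rewrite /twist/= conjcM mulrACA ph_norm mul1r.
Qed.

Lemma controlled_run (U : qop R (A * M)%type) psi beta x b :
  qapply (liftB controlled) (qapply (liftA U) (qprod psi beta)) (x, b) =
  beta b * twist b (qapply U psi) x.
Proof.
case: x => a m; rewrite qapply_liftB.
rewrite (eq_qapply _ _ (fun j => qapply U psi (a, j.1) * beta j.2)); last first.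
  by move=> j /=; rewrite qapply_liftA.
transitivity (\sum_j (j == (act b m, b))%:R *
    (ph b m * (qapply U psi (a, j.1) * beta j.2))).
  by apply: eq_bigr => j _; rewrite /controlled !mulrA.
by rewrite sum_natb /twist/=; ring.
Qed.

End Controlled.

(** Bob's register serves only as a control, so tracing it out leaves a classical mixture of the
    [chi b]: the amplitudes of his initial state act as random coins. *)
Lemma qjoint_id E (F : qop R B) (s : qvec R (A * M * B)%type) beta
    (chi : B -> qvec R (A * M)%type) :
  (forall i j, F i j = (i == j)%:R) ->
  (forall x b, s (x, b) = beta b * chi b x) ->
  qjoint E F s = \sum_b ((beta b)^* * beta b) * qform (chi b) E (chi b).
Proof.
move=> hF hs; rewrite /qjoint /qform sum_pair exchange_big; apply: eq_bigr => b _ /=.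
rewrite mulr_sumr; apply: eq_bigr => x _.
rewrite sum_pair mulr_sumr; apply: eq_bigr => y _.
rewrite -[RHS](sum_natb_const b); apply: eq_bigr => c _.
rewrite [LHS]/= hF !hs [b == c]eq_sym conjcM.
by case: (eqVneq c b) => [->|_]; rewrite ?mulr1n ?mulr0n; ring.
Qed.

Definition message_out (V : qop R (M * B)%type) beta (m : M) : qvec R (M * B)%type :=
  qapply V (fun j => (j.1 == m)%:R * beta j.2).

(** The sum over [m'] traces out the message that Bob returns. *)
Definition guess_prob (V : qop R (M * B)%type) beta (F : qop R B) (m : M) : R[i] :=
  \sum_m' qform (fun b => message_out V beta m (m', b)) F
                (fun b => message_out V beta m (m', b)).

Lemma guess_prob_ge0 V beta F m : qpsd F -> 0 <= guess_prob V beta F m.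
Proof. by move=> hF; apply: sumr_ge0 => m' _; apply: hF. Qed.

Lemma guess_prob_sum {O : finType} V beta (F : O -> qop R B) m :
  qunitary V -> qnormalized beta -> qpovm F ->
  \sum_o guess_prob V beta (F o) m = 1.
Proof.
move=> hV hb hF; rewrite exchange_big/=.
under eq_bigr => m' _ do rewrite (qpovm_dot _ _ _ hF).
rewrite -[LHS](sum_pair (fun p => (message_out V beta m p)^* * message_out V beta m p)).
rewrite -/(qdot _ _) qunitary_dot// /qdot sum_pair.
rewrite -[RHS]hb -[RHS](sum_natb_const m); apply: eq_bigr => m' _.
rewrite mulr_sumr; apply: eq_bigr => b _ /=.
by rewrite conjcM conjc_nat; case: eqP => _; rewrite ?mulr1n ?mulr0n; ring.
Qed.

(** Alice's register determines the message and is traced out by the identity [E], so what Bob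
    receives is a classical mixture of basis messages. *)
Lemma qjoint_message (V : qop R (M * B)%type) (E : qop R (A * M)%type) F psi beta
    (c : A -> R[i]) (msg : A -> M) :
  (forall i j, E i j = (i == j)%:R) ->
  (forall x m, psi (x, m) = (m == msg x)%:R * c x) ->
  qjoint E F (qapply (liftB V) (qapply (liftA qid) (qprod psi beta))) =
  \sum_x ((c x)^* * c x) * guess_prob V beta F (msg x).
Proof.
move=> hE hpsi; set s := qapply _ _.
have hs x m b : s (x, m, b) = c x * message_out V beta (msg x) (m, b).
  rewrite /s qapply_liftB /message_out /qapply mulr_sumr; apply: eq_bigr => j _.
  by rewrite -/(qapply _ _ _) qapply_liftA /qprod/= qapply_id hpsi; ring.
rewrite /qjoint /qform sum_pair sum_pair; apply: eq_bigr => x _.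
rewrite /guess_prob mulr_sumr; apply: eq_bigr => m _.
rewrite mulr_sumr; apply: eq_bigr => b _; rewrite sum_pair exchange_big mulr_sumr.
apply: eq_bigr => b' _.
rewrite -[RHS](sum_natb_const (x, m)); apply: eq_bigr => y _.
rewrite [LHS]/= hE [_ == y]eq_sym !hs conjcM.
by case: (eqVneq y (x, m)) => [->|_]; rewrite ?hs ?mulr1n ?mulr0n; ring.
Qed.

End OneRound.

(** * The protocol *)

(* [inl (Some c)] is the basis state [c], [inl None] is the basis state [2], and the two
   [inr _] are the full messages. *)
Definition message := (option bool + bool)%type.
(* A register sent along with the message, into which Bob XORs the bits that he discloses. *)
Definition response := (bool * bool * bool)%type.
(* Bob's register [((x0, x1), (test, y))]: in the test [y] is the index of the bit encoded in
   the phases, otherwise [y] is the random sign. *)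
Definition setting := ((bool * bool) * (bool * bool))%type.

Definition rxor (r s : response) : response :=
  (r.1.1 (+) s.1.1, r.1.2 (+) s.1.2, r.2 (+) s.2).

Lemma rxorK s : involutive (rxor^~ s).
Proof. by move: s => [[a b] c] [[x y] z]; rewrite /rxor/= !addbK. Qed.

Lemma rxorI r : injective (rxor r).
Proof.
move: r => [[a b] c] [[x y] z] [[x' y'] z'] [].
by move=> /(can_inj (addKb _)) -> /(can_inj (addKb _)) -> /(can_inj (addKb _)) ->.
Qed.

Lemma sum_message {V : nmodType} (F : message -> V) :
  \sum_m F m = \sum_y F (inl (Some y)) + F (inl None) + \sum_y F (inr y).
Proof.
rewrite big_sumType/=; congr (_ + _).
rewrite (bigD1 None)//= addrC; congr (_ + _).
rewrite (reindex_omap Some id) => [|[y|]]//.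
by apply: eq_bigl => y; rewrite eqxx.
Qed.

Lemma sum_rank {T : finType} {V : nmodType} (F : 'I_#|T| -> V) :
  \sum_i F i = \sum_t F (enum_rank t).
Proof. by rewrite (reindex _ (onW_bij _ (@enum_rank_bij T))). Qed.

Section Protocol.
Context {R : realType}.
Variables (p delta : R).

(* A unit complex number only if [|x| <= 1]. *)
Definition unit_of_re (x : R) : R[i] := (x +i* Num.sqrt (1 - x ^+ 2))%C.

(** The phases come in conjugate pairs to which honest Alice gives equal weights, so that their
    imaginary parts cancel. This is why there are two full messages. *)
Definition test_phase (m : message) : R[i] :=
  match m with
  | inl (Some _) => unit_of_re p
  | inl None => (unit_of_re p)^*
  | inr true => unit_of_re (p - 1)
  | inr false => (unit_of_re (p - 1))^*
  end.

Definition is_full (m : message) := if m is inr _ then true else false.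

Definition sgn (y : bool) : R[i] := (-1) ^+ y.

Definition phase (d : setting) (m : message) : R[i] :=
  let: ((x0, x1), (test, y)) := d in
  if test then (if sel y x0 x1 then test_phase m else 1)
  else match m with
       | inl (Some c) => sgn (y (+) sel c x0 x1)
       | inl None => sgn y
       | inr _ => 1
       end.

(** The first bit announces a test; the other two are then the index of the encoded bit and the
    value of the other bit. *)
Definition shift (d : setting) (m : message) : response :=
  let: ((x0, x1), (test, y)) := d in
  if test then (true, y, sel (~~ y) x0 x1)
  else if is_full m then (false, x0, x1) else (false, false, false).

Definition weight (a : bool) (m : message) : R :=
  match m with
  | inl (Some y) => if y == a then (1 - p) / 2 else 0
  | inl None => (1 - p) / 2
  | inr _ => p / 2
  end.

Definition setting_prob (test : bool) : R := if test then delta / 2 else (1 - delta) / 2.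

Local Notation AT := 'I_#|{: bool * message}|.
Local Notation MT := 'I_#|{: message * response}|.
Local Notation BT := 'I_#|{: setting}|.

Definition label (m : MT) : message := (enum_val m).1.

Definition bob_phase (d : setting) (m : MT) : R[i] := phase d (label m).

Definition bob_act (d : setting) (m : MT) : MT :=
  enum_rank (label m, rxor (enum_val m).2 (shift d (label m))).

Definition alice_message (x : AT) : MT :=
  enum_rank ((enum_val x).2, (false, false, false)).

(** Alice's register holds her choice bit next to a copy of the message. Hence one measurement can
    serve both choices, and states for different choices are orthogonal. *)
Definition alice_amp (a : bool) (x : AT) : R[i] :=
  ((enum_val x).1 == a)%:R * (Num.sqrt (weight a (enum_val x).2))%:C.

Definition alice_init (a : bool) : qvec R (AT * MT)%type :=
  fun i => (i.2 == alice_message i.1)%:R * alice_amp a i.1.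

Definition bob_init (x0 x1 : bool) : qvec R BT :=
  fun b => ((enum_val b).1 == (x0, x1))%:R * (Num.sqrt (setting_prob (enum_val b).2.1))%:C.

Definition bob_unitary : qop R (MT * BT)%type :=
  controlled (fun b => bob_phase (enum_val b)) (fun b => bob_act (enum_val b)).

(** The decoding measurement [D] is a parameter, to be supplied by [perfect_discrimination]. Neither
    party ever aborts. *)
Definition protocol (D : bool -> qop R (AT * MT)%type) : ot_protocol R :=
  {| dA := #|{: bool * message}|; dM := #|{: message * response}|; dB := #|{: setting}|;
     nrounds := 1;
     initA := alice_init; initB := bob_init;
     UA := fun=> qid; UB := fun=> bob_unitary;
     outA := fun o => if o is Some y then D y else fun _ _ => 0;
     outB := fun acc => if acc then qid else fun _ _ => 0 |}.

Hypotheses (p_ge0 : 0 <= p) (p_le1 : p <= 1).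
Hypotheses (delta_gt0 : 0 < delta) (delta_lt1 : delta < 1).

Lemma unit_of_reN (x : R) : x ^+ 2 <= 1 -> (unit_of_re x)^* * unit_of_re x = 1.
Proof.
move=> x1; apply/eqP; rewrite eq_complex /unit_of_re /=; simpc.
rewrite -!expr2 sqr_sqrtr ?subr_ge0// addrC subrK eqxx/=.
by apply/eqP; ring.
Qed.

Lemma unit_of_reD (x : R) : unit_of_re x + (unit_of_re x)^* = 2 * x%:C.
Proof. exact: addcJ. Qed.

Lemma test_phase_norm m : (test_phase m)^* * test_phase m = 1.
Proof.
have hp : p ^+ 2 <= 1 by rewrite expr_le1.
have hp' : (p - 1) ^+ 2 <= 1 by rewrite -sqrrN opprB expr_le1// ?subr_ge0// gerBl.
by case: m => [[y|]|[]] /=; rewrite ?conjcK 1?mulrC ?unit_of_reN// mulrC unit_of_reN.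
Qed.

Lemma test_phase_re m : test_phase m + (test_phase m)^* = 2 * (p%:C - (is_full m)%:R).
Proof.
by case: m => [[y|]|[]] /=; rewrite ?conjcK; rewrite 1?[_^* + _]addrC unit_of_reD
   ?rmorphB ?subr0.
Qed.

Lemma sgn_norm y : (sgn y)^* * sgn y = 1.
Proof. by case: y; rewrite /sgn ?expr0 ?expr1 ?conjcN ?conjc1 ?mulrNN mulr1. Qed.

Lemma phase_norm d m : (phase d m)^* * phase d m = 1.
Proof.
have one : (1 : R[i])^* * 1 = 1 by rewrite conjc1 mulr1.
case: d => [[x0 x1] [[] y]] /=; first by case: ifP; rewrite ?test_phase_norm.
by case: m => [[c|]|z]; rewrite ?sgn_norm.
Qed.

Lemma label_act d m : label (bob_act d m) = label m.
Proof. by rewrite /label /bob_act enum_rankK. Qed.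

Lemma bob_actK d : involutive (bob_act d).
Proof.
move=> m; rewrite {1}/bob_act label_act /bob_act enum_rankK/= rxorK /label.
by rewrite -surjective_pairing enum_valK.
Qed.

Lemma bob_phase_norm d m : (bob_phase d m)^* * bob_phase d m = 1.
Proof. exact: phase_norm. Qed.

Lemma eq_bob_act d d' m : shift d (label m) = shift d' (label m) ->
  bob_act d m = bob_act d' m.
Proof. by rewrite /bob_act => ->. Qed.

Lemma bob_act_id d m : shift d (label m) = (false, false, false) -> bob_act d m = m.
Proof.
rewrite /bob_act => ->; rewrite /rxor /= !addbF -!surjective_pairing.
by rewrite enum_valK.
Qed.

Lemma setting_prob_gt0 t : 0 < setting_prob t.
Proof. by case: t; rewrite /setting_prob divr_gt0// subr_gt0. Qed.

Lemma sqrtc_sq (x : R) : 0 <= x -> ((Num.sqrt x)%:C)^* * (Num.sqrt x)%:C = x%:C.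
Proof. by move=> x0; rewrite conjc_real -rmorphM -expr2 sqr_sqrtr. Qed.

Lemma weight_ge0 a m : 0 <= weight a m.
Proof.
by case: m => [[y|]|y] /=; [case: ifP => // _| |]; rewrite ?divr_ge0 ?subr_ge0.
Qed.

Lemma bob_init_sum x0 x1 (F : setting -> R[i]) :
  \sum_(b : BT) ((bob_init x0 x1 b)^* * bob_init x0 x1 b) * F (enum_val b) =
  \sum_t \sum_y (setting_prob t)%:C * F ((x0, x1), (t, y)).
Proof.
rewrite sum_rank sum_pair -[RHS](sum_natb_const (x0, x1)); apply: eq_bigr => x _.
rewrite [\sum_t \sum_y _]pair_bigA mulr_sumr; apply: eq_bigr => -[t y] _.
rewrite /bob_init enum_rankK/= conjcM conjc_nat mulrACA sqrtc_sq; last first.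
  exact/ltW/setting_prob_gt0.
by case: eqP => [->|_]; rewrite ?mulr1n ?mulr0n; ring.
Qed.

Lemma alice_amp_sum (a : bool) (F : message -> R[i]) :
  \sum_(x : AT) ((alice_amp a x)^* * alice_amp a x) * F (enum_val x).2 =
  \sum_m (weight a m)%:C * F m.
Proof.
rewrite sum_rank sum_pair -[RHS](sum_natb_const a); apply: eq_bigr => y _.
rewrite mulr_sumr; apply: eq_bigr => m _.
rewrite /alice_amp enum_rankK/= conjcM conjc_nat mulrACA sqrtc_sq ?weight_ge0//.
by case: eqP => _; rewrite ?mulr1n ?mulr0n; ring.
Qed.

End Protocol.

(** * Cheating Alice *)

Section CheatingAlice.
Context {R : realType}.
Variables (p delta : R).
Hypotheses (p_ge0 : 0 <= p) (p_le1 : p <= 1).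
Hypotheses (delta_gt0 : 0 < delta) (delta_lt1 : delta < 1).

Local Notation MT := 'I_#|{: message * response}|.

Context {K : finType}.
Variable (phi : qvec R (K * MT)%type).
Hypothesis phi_norm : qdot phi phi = 1.

Local Notation tw d := (twist (bob_phase p) bob_act d phi).
Local Notation prob i := ((phi i)^* * phi i).

Lemma twist_norm d : qdot (tw d) (tw d) = 1.
Proof.
by rewrite dot_twist ?phi_norm//; [exact: bob_phase_norm | exact: bob_actK].
Qed.

Lemma sum_act d (g : message -> R[i]) :
  \sum_(i : K * MT) g (label i.2) *
    ((phi (i.1, bob_act d i.2))^* * phi (i.1, bob_act d i.2)) =
  \sum_(i : K * MT) g (label i.2) * prob i.
Proof.
rewrite !sum_pair; apply: eq_bigr => k _.
rewrite [RHS](reindex_inj (inv_inj (bob_actK d))); apply: eq_bigr => m _ /=.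
by rewrite label_act.
Qed.

(** When the same bits are disclosed, Bob applies the same permutation in both settings; it cancels,
    and only the phases remain. *)
Lemma dot_twist_shift d d' : shift d =1 shift d' ->
  qdot (tw d) (tw d') =
  \sum_(i : K * MT) ((phase p d (label i.2))^* * phase p d' (label i.2)) * prob i.
Proof.
move=> sh; rewrite -(sum_act d (fun m => (phase p d m)^* * phase p d' m)).
apply: eq_bigr => i _; rewrite /twist (eq_bob_act d' d)// conjcM /bob_phase.
by rewrite -!mulrA [X in _ * X]mulrCA.
Qed.

(* The pair [(x0, x1)] with [x_c = y] and [x_(1-c) = z]. *)
Definition bits_of (c y z : bool) : bool * bool := (sel c y z, sel c z y).

Lemma sum_bits (c : bool) (F : bool -> bool -> R[i]) :
  \sum_x0 \sum_x1 F x0 x1 = \sum_y \sum_z F (bits_of c y z).1 (bits_of c y z).2.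
Proof. by case: c => //; rewrite exchange_big. Qed.

Definition full_part (d : setting) : qvec R (K * MT)%type :=
  fun i => if is_full (label i.2) then phi (i.1, bob_act d i.2) else 0.

(** Here [phi] is not permuted, since without a test [shift] vanishes on messages that are not
    full. *)
Definition masked_part (d : setting) : qvec R (K * MT)%type :=
  fun i => if is_full (label i.2) then 0 else phase p d (label i.2) * phi i.

(** Without a test, Bob's sign [y] multiplies exactly the messages that are not full, and the
    disclosed bits do not depend on it. *)
Lemma twist_normal x y : tw (x, (false, y)) =1
  (fun i => full_part (x, (false, false)) i +
            (if y then -1 else 1) * masked_part (x, (false, false)) i).
Proof.
case: x => x0 x1 [k m]; rewrite /full_part /masked_part /twist /bob_phase/=.
have := bob_act_id (x0, x1, (false, y)) m.
have := eq_bob_act (x0, x1, (false, y)) (x0, x1, (false, false)) m.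
case: (label m) => [o|z] /= h1 h2; last by rewrite h1// mul1r mulr0 addr0.
rewrite h2// add0r mulrA; congr (_ * _).
by case: o => [c|]; case: y {h1 h2} => //=; rewrite ?mul1r// /sgn; 
  case: (sel _ _ _); rewrite /= ?expr0 ?expr1 ?mulrNN ?mulr1.
Qed.

Lemma full_part_norm d : qdot (full_part d) (full_part d) =
  \sum_(i : K * MT) (is_full (label i.2))%:R * prob i.
Proof.
rewrite -(sum_act d (fun m => (is_full m)%:R)); apply: eq_bigr => i _.
by rewrite /full_part; case: ifP => _; rewrite ?mul1r// mul0r mulr0.
Qed.

Lemma masked_part_norm d : qdot (masked_part d) (masked_part d) =
  1 - \sum_(i : K * MT) (is_full (label i.2))%:R * prob i.
Proof.
rewrite -[X in X - _]phi_norm -sumrB; apply: eq_bigr => i _.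
rewrite /masked_part; case: ifP => _; first by rewrite mul1r subrr mulr0.
by rewrite conjcM mulrACA phase_norm// mul1r mul0r subr0.
Qed.

(** * Consequences of learning one bit with certainty *)

Section Certain.
Variables (E : bool * bool -> qop R (K * MT)%type) (c : bool).
Hypothesis (E_povm : qpovm E).
Hypothesis certain : forall d : setting,
  \sum_(g | sel c g.1 g.2 == sel c d.1.1 d.1.2) qform (tw d) (E g) (tw d) = 1.

Lemma twist_orth (d d' : setting) : sel c d.1.1 d.1.2 != sel c d'.1.1 d'.1.2 ->
  qdot (tw d) (tw d') = 0.
Proof.
move=> ne; apply: (qpovm_certain E (fun g => sel c g.1 g.2 == sel c d.1.1 d.1.2)) => //.
  by rewrite twist_norm certain.
rewrite twist_norm -(certain d'); apply: eq_bigl => g.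
by move: ne; do 3!case: (sel _ _ _).
Qed.

Lemma full_weight : \sum_(i : K * MT) (is_full (label i.2))%:R * prob i = p%:C.
Proof.
(* Bit [c] is tested and the other bit is fixed, so both settings disclose the same bits and differ
   only in the phases, 1 against [test_phase]. *)
pose d y : setting := (bits_of c y false, (true, c)).
have orth : qdot (tw (d false)) (tw (d true)) = 0.
  by apply: twist_orth; rewrite /d /bits_of/=; case: (c).
rewrite dot_twist_shift in orth; last by move=> m; rewrite /d /bits_of/=; case: (c).
have {}orth : \sum_(i : K * MT) test_phase p (label i.2) * prob i = 0.
  rewrite -[RHS]orth; apply: eq_bigr => i _; congr (_ * _).
  by rewrite /d /bits_of; case: (c); rewrite /= conjc1 mul1r.
(* Adding the conjugate relation keeps only the real parts, which are known from [test_phase_re]. *)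
have : \sum_(i : K * MT) (test_phase p (label i.2) + (test_phase p (label i.2))^*) * prob i = 0.
  under eq_bigr => i _ do rewrite mulrDl.
  rewrite big_split/= orth add0r -[RHS]conjc0 -[in RHS]orth conjc_sum.
  by apply: eq_bigr => i _; rewrite !conjcM conjcK; ring.
under eq_bigr => i _ do rewrite test_phase_re -mulrA mulrBl mulrBr.
rewrite sumrB -!mulr_sumr -[\sum_i prob i]/(qdot phi phi) phi_norm mulr1 -mulrBr.
by move/eqP; rewrite mulf_eq0 pnatr_eq0/= subr_eq0 => /eqP.
Qed.

(* Averaging the orthogonality relations over Bob's sign isolates the masked block, and then
   over [x_(1-c)] the message [1 - c]. *)
Lemma no_other_message i : label i.2 = inl (Some (~~ c)) -> phi i = 0.
Proof.
move=> hi; pose d y z : setting := (bits_of c y z, (false, false)).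
pose d1 y z : setting := (bits_of c y z, (false, true)).
have orth z : qdot (tw (d false false)) (masked_part (d true z)) = 0.
  have o1 : qdot (tw (d false false)) (tw (d true z)) = 0.
    by apply: twist_orth; rewrite /d /bits_of/=; case: (c).
  have o2 : qdot (tw (d false false)) (tw (d1 true z)) = 0.
    by apply: twist_orth; rewrite /d /d1 /bits_of/=; case: (c).
  rewrite (eq_qdot _ _ _ _ (frefl _) (twist_normal _ _)) qdotDr in o1.
  rewrite (eq_qdot _ _ _ _ (frefl _) (twist_normal _ _)) qdotDr in o2.
  have : 2 * qdot (tw (d false false)) (masked_part (d true z)) = 0.
    by rewrite -[RHS](subrr 0) -{1}o1 -o2; ring.
  by move/eqP; rewrite mulf_eq0 pnatr_eq0/= => /eqP.
(* The component of [phi] on the message [1 - c]. *)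
pose u : qvec R (K * MT)%type := fun i => if label i.2 == inl (Some (~~ c)) then phi i else 0.
have u0 : qdot u u = 0.
  have : 2 * qdot u u = 0.
    (* Flipping the other bit changes the masked part only in the sign of the message [1 - c], so
       the difference is [2 u]; the left-hand state has phase 1 there. *)
    transitivity (qdot (tw (d false false))
        (fun i => masked_part (d true false) i + (-1) * masked_part (d true true) i)).
      rewrite /qdot mulr_sumr; apply: eq_bigr => -[k m] _.
      rewrite (twist_normal _ _ (k, m)) /u /full_part /masked_part /d /bits_of /=.
      case: (label m) => [[y|]|y] /=; last by ring.
        by case: (c); case: y;
          rewrite /= /sgn ?eqxx ?expr0 ?expr1 ?conjcD ?conjcM ?conjcN ?conjc1; ring.
      by rewrite /sgn expr0; ring.
    by rewrite qdotDr !orth mulr0 addr0.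
  by move/eqP; rewrite mulf_eq0 pnatr_eq0/= => /eqP.
by have := qdot_eq0 _ u0 i; rewrite /u hi eqxx.
Qed.

(** The other bit enters only through the phase of the message [1 - c], where [phi] vanishes. The
    masked part thus reveals nothing about that bit. *)
Lemma masked_part_bits y z z' :
  masked_part (bits_of c y z, (false, false)) =1 masked_part (bits_of c y z', (false, false)).
Proof.
move=> i; rewrite /masked_part; case E0 : (label i.2) => [[o|]|//]//=.
have [oc|] := eqVneq o (~~ c).
  by rewrite (no_other_message i) ?mulr0// E0 oc.
by move=> oc; congr (_ * _); move: {E0} o oc; case: (c) => -[].
Qed.

(** Tests and full messages are conceded to Alice. On the masked part her state is independent of
    the other bit, so her success probabilities for its two values add up to the masked weight
    [1 - p]. *)
Lemma guess_success :
  4%:R^-1 * (\sum_x0 \sum_x1 \sum_t \sum_y (setting_prob delta t)%:C *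
    \sum_(g | sel (~~ c) g.1 g.2 == sel (~~ c) x0 x1)
      qform (tw (x0, x1, (t, y))) (E g) (tw (x0, x1, (t, y))))
  <= ((1 + p) / 2 + delta)%:C.
Proof.
pose guess z (v : qvec R (K * MT)%type) :=
  \sum_(g | sel (~~ c) g.1 g.2 == z) qform v (E g) v.
pose N y := masked_part (bits_of c y false, (false, false)).
pose D : R[i] := delta%:C; pose P : R[i] := p%:C.
have D0 : 0 <= D by rewrite ler0c ltW.
have D1 : 0 <= 1 - D by rewrite -(rmorph1 (real_complex R)) -rmorphB ler0c subr_ge0 ltW.
have P0 : 0 <= P by rewrite ler0c.
have prob_test : (setting_prob delta true)%:C = D / 2.
  by rewrite /setting_prob rmorphM fmorphV rmorph_nat.
have prob_normal : (setting_prob delta false)%:C = (1 - D) / 2.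
  by rewrite /setting_prob rmorphM fmorphV rmorph_nat rmorphB rmorph1.
have guess1 z d : guess z (tw d) <= 1 by rewrite -(twist_norm d) qpovm_le1.
have bound y z :
  \sum_t \sum_s (setting_prob delta t)%:C * guess z (tw (bits_of c y z, (t, s)))
  <= D + (1 - D) * (P + guess z (N y)).
  rewrite !big_bool /= prob_test prob_normal; apply: lerD.
    rewrite -mulrDr -[leRHS](divfK (_ : 2 != 0))// ?pnatr_eq0//.
    rewrite ler_wpM2l ?divr_ge0//; rewrite -[leRHS]/(1 + 1); exact: lerD.
  (* The two values of Bob's sign combine by the parallelogram identity into separate full and
     masked contributions. *)
  pose F := full_part (bits_of c y z, (false, false)).
  rewrite -mulrDr (_ : guess z (tw (bits_of c y z, (false, true))) +
            guess z (tw (bits_of c y z, (false, false))) =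
            2 * (guess z F + guess z (N y))); last first.
    rewrite /guess -!big_split mulr_sumr; apply: eq_bigr => g _ /=.
    rewrite -qform_parallelogram addrC; congr (_ + _); apply: eq_qform => i;
      by rewrite twist_normal /N (masked_part_bits y z false).
  rewrite mulrA divfK ?pnatr_eq0// ler_wpM2l// lerD2r.
  by rewrite /P -full_weight -(full_part_norm (bits_of c y z, (false, false))) qpovm_le1.
have total y : \sum_z guess z (N y) = 1 - P.
  rewrite /P -full_weight -(masked_part_norm (bits_of c y false, (false, false))).
  rewrite -(qpovm_dot E _ _ E_povm) (partition_big (fun g => sel (~~ c) g.1 g.2) predT)//=.
rewrite (sum_bits c).
apply: (@le_trans _ _ (4%:R^-1 * \sum_y \sum_z (D + (1 - D) * (P + guess z (N y))))).
  rewrite ler_wpM2l ?invr_ge0 ?ler0n//; apply: ler_sum => y _; apply: ler_sum => z _.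
  apply: le_trans (bound y z); rewrite le_eqVlt; apply/orP; left; apply/eqP.
  by apply: eq_bigr => t _; apply: eq_bigr => s _; rewrite /guess /bits_of; case: (c).
rewrite rmorphD rmorphM fmorphV rmorph_nat rmorphD rmorph1 /= -/D -/P.
have -> : \sum_y \sum_z (D + (1 - D) * (P + guess z (N y))) =
          4%:R * (D + (1 - D) * P) + (1 - D) * (2 * (1 - P)).
  have -> : 2 * (1 - P) = \sum_y \sum_z guess z (N y).
    by under eq_bigr => y _ do rewrite total; rewrite big_bool /=; ring.
  by rewrite !big_bool /=; ring.
(* The left-hand side equals [D + (1 - D) (1 + P) / 2]. *)
rewrite -subr_ge0 (_ : _ - _ = D * (1 + P) / 2); last by field.
by rewrite divr_ge0 ?mulr_ge0 ?addr_ge0.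
Qed.

End Certain.
End CheatingAlice.

(** * Completeness and cheating Bob *)

Section Honest.
Context {R : realType}.
Variables (p delta : R).
Hypotheses (p_ge0 : 0 <= p) (p_le1 : p <= 1).
Hypotheses (delta_gt0 : 0 < delta) (delta_lt1 : delta < 1).

Local Notation AT := 'I_#|{: bool * message}|.
Local Notation MT := 'I_#|{: message * response}|.
Local Notation BT := 'I_#|{: setting}|.
Local Notation tw d phi := (twist (bob_phase p) bob_act d phi).

Lemma label_alice_message x : label (alice_message x) = (enum_val x).2.
Proof. by rewrite /label enum_rankK. Qed.

(** The copy of the message in Alice's register makes the sum diagonal in [m]; a term survives only
    if both settings disclose the same bits on [m]. *)
Lemma honest_dot a d d' :
  qdot (tw d (alice_init p a)) (tw d' (alice_init p a)) =
  \sum_m (weight p a m)%:C *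
    ((phase p d m)^* * phase p d' m * (shift d m == shift d' m)%:R).
Proof.
rewrite -(alice_amp_sum p p_ge0 p_le1 a
  (fun m => (phase p d m)^* * phase p d' m * (shift d m == shift d' m)%:R)).
rewrite /qdot sum_pair; apply: eq_bigr => x _.
rewrite -[RHS](sum_natb_const (bob_act d (alice_message x))); apply: eq_bigr => m _.
rewrite /twist /alice_init/= -(can2_eq (bob_actK d) (bob_actK d)).
case: eqP => [e|_]; last by rewrite !mul0r conjcM conjc0 !mulr0 !mul0r.
have -> : m = bob_act d (alice_message x) by rewrite -e bob_actK.
have -> : (bob_act d' (bob_act d (alice_message x)) == alice_message x) =
          (shift d (enum_val x).2 == shift d' (enum_val x).2).
  rewrite (can2_eq (bob_actK d') (bob_actK d')) /bob_act (inj_eq enum_rank_inj).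
  by rewrite label_alice_message xpair_eqE eqxx (inj_eq (rxorI _)).
rewrite /bob_phase label_act label_alice_message !conjcM !mulr1n.
by rewrite conjc1; ring.
Qed.

Lemma honest_norm a : qdot (alice_init p a) (alice_init p a) = 1.
Proof.
pose d : setting := (false, false, (false, false)).
rewrite -(dot_twist (bob_phase p) bob_act (bob_phase_norm p p_ge0 p_le1) bob_actK d).
rewrite honest_dot.
under eq_bigr => m _ do rewrite eqxx mulr1 phase_norm// mulr1.
rewrite -rmorph_sum sum_message !big_bool -[RHS](rmorph1 (real_complex R)); congr _%:C.
by case: a => /=; field.
Qed.

(** The real part is [(1 - p) p + p (p - 1)], and the imaginary parts cancel within conjugate pairs.
    So honest Alice meets the constraint that the test forces on a cheater. *)
Lemma weight_test_phase a : \sum_m (weight p a m)%:C * test_phase p m = 0.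
Proof.
rewrite sum_message !big_bool /=.
have eF : (unit_of_re (p - 1))^* = 2 * (p%:C - 1) - unit_of_re (p - 1).
  by rewrite -(rmorph1 (real_complex R)) -rmorphB -unit_of_reD; ring.
have eN : (unit_of_re p)^* = 2 * p%:C - unit_of_re p.
  by rewrite -unit_of_reD; ring.
have w1 : ((1 - p) / 2)%:C = (1 - p%:C) / 2.
  by rewrite rmorphM fmorphV rmorph_nat rmorphB rmorph1.
have w2 : (p / 2)%:C = p%:C / 2 by rewrite rmorphM fmorphV rmorph_nat.
by case: a => /=; rewrite eF eN w1 w2; field.
Qed.

Lemma honest_orth a a' d d' :
  sel a d.1.1 d.1.2 != sel a' d'.1.1 d'.1.2 ->
  qdot (tw d (alice_init p a)) (tw d' (alice_init p a')) = 0.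
Proof.
have [<-|na _] := eqVneq a a'; last first.
  rewrite /qdot big1// => -[x m] _; rewrite /twist /alice_init /alice_amp/=.
  case: (eqVneq (enum_val x).1 a) => [->|_]; first by rewrite (negPf na) mul0r !mulr0.
  by rewrite mul0r !mulr0 conjc0 mul0r.
case: d d' => [[x0 x1] [t y]] [[x0' x1'] [t' y']]; rewrite honest_dot /=.
case: t t' => -[] /= ne; last first.
(* No test: full messages disclose different pairs, and the terms of the messages [a] and 2 are
   opposite because the values of [x_a] differ. *)
- rewrite sum_message !big_bool /= !mulr1n.
  rewrite [((false, x0, x1) == _)](_ : _ = false) ?mulr0n; last first.
    by apply/negP => /eqP[e0 e1]; move: ne; rewrite e0 e1 eqxx.
  by case: a ne; move: x0 x1 x0' x1' y y' => [] [] [] [] [] [] //= _;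
    rewrite /sgn ?expr0 ?expr1 ?conjcN ?conjc1; ring.
- by rewrite big1// => m _; case: (is_full m); rewrite /= mulr0n !mulr0.
- by rewrite big1// => m _; case: (is_full m); rewrite /= mulr0n !mulr0.
(* Two tests that disclose the same bits must encode bit [a], as otherwise the differing value of
   [x_a] would be disclosed; [weight_test_phase] then applies, up to conjugation. *)
have [[<- e]|_] := eqVneq (true, y, sel (~~ y) x0 x1) (true, y', sel (~~ y') x0' x1').
  have {ne}e : sel y x0' x1' = ~~ sel y x0 x1.
    by move: ne e; case: a; case: y; case: x0; case: x1; case: x0'; case: x1'.
  under eq_bigr => m _ do rewrite mulr1n mulr1 e.
  case: (sel y x0 x1) => /=; last first.
    by under eq_bigr => m _ do rewrite conjc1 mul1r; exact: weight_test_phase.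
  have := congr1 conjc (weight_test_phase a).
  rewrite conjc0 conjc_sum => e0; rewrite -[RHS]e0; apply: eq_bigr => m _.
  by rewrite conjcM conjc_real mulr1.
by rewrite big1// => m _; rewrite mulr0n !mulr0.
Qed.

End Honest.

(** * The guarantees of the protocol *)

Section Main.
Context {R : realType}.
Variables (p delta : R).
Hypotheses (p_ge0 : 0 <= p) (p_le1 : p <= 1).
Hypotheses (delta_gt0 : 0 < delta) (delta_lt1 : delta < 1).

Local Notation AT := 'I_#|{: bool * message}|.
Local Notation MT := 'I_#|{: message * response}|.
Local Notation BT := 'I_#|{: setting}|.
Local Notation tw d phi := (twist (bob_phase p) bob_act d phi).

Lemma qunitary_bob : qunitary (bob_unitary p).
Proof.
by apply: qunitary_controlled => b; [exact: bob_phase_norm | exact: bob_actK].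
Qed.

Lemma setting_prob_sum : \sum_(t : bool) \sum_(y : bool) (setting_prob delta t)%:C = 1 :> R[i].
Proof.
rewrite !big_bool /= -!rmorphD -[RHS](rmorph1 (real_complex R)); congr _%:C.
by field.
Qed.

Lemma bob_init_norm x0 x1 : qnormalized (bob_init delta x0 x1).
Proof.
rewrite /qnormalized; under eq_bigr => b _ do rewrite -[_ * _]mulr1.
rewrite (bob_init_sum delta delta_gt0 delta_lt1 x0 x1 (fun=> 1)) -[RHS]setting_prob_sum.
by apply: eq_bigr => t _; apply: eq_bigr => y _; rewrite mulr1.
Qed.

Lemma qjoint_zero {A M B : finType} (E : qop R (A * M)%type) (s : qvec R (A * M * B)%type) :
  qjoint E (fun _ _ => 0) s = 0.
Proof.
rewrite /qjoint /qform big1// => i _; rewrite big1// => j _.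
by rewrite mulr0 mulr0 mul0r.
Qed.

Lemma qjoint_sum {O A M B : finType} (E : O -> qop R (A * M)%type) (F : qop R B)
    (s : qvec R (A * M * B)%type) :
  \sum_o qjoint (E o) F s = qjoint (fun i j => \sum_o E o i j) F s.
Proof.
rewrite /qjoint -(qform_sum predT (fun o i j => E o i.1 j.1 * F i.2 j.2)).
by apply: eq_bigr => i _; apply: eq_bigr => j _; rewrite mulr_suml.
Qed.

Lemma qjoint_run {A : finType} (E U : qop R (A * MT)%type) psi x0 x1 :
  qjoint E qid (qapply (liftB (bob_unitary p))
    (qapply (liftA U) (qprod psi (bob_init delta x0 x1)))) =
  \sum_t \sum_y (setting_prob delta t)%:C *
     qform (tw (x0, x1, (t, y)) (qapply U psi)) E (tw (x0, x1, (t, y)) (qapply U psi)).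
Proof.
rewrite (qjoint_id E qid _ (bob_init delta x0 x1)
  (fun b => tw (enum_val b) (qapply U psi)))//.
  exact: (bob_init_sum delta delta_gt0 delta_lt1 x0 x1
    (fun d => qform (tw d (qapply U psi)) E (tw d (qapply U psi)))).
by move=> x b; rewrite controlled_run.
Qed.

Lemma protocol_ok D : qpovm D ->
  (forall a d, qform (tw d (alice_init p a)) (D (sel a d.1.1 d.1.2)) (tw d (alice_init p a)) = 1) ->
  ot_protocol_ok (protocol p delta D).
Proof.
move=> [psdD sumD] hD; split.
  split; first by move=> a; apply: honest_norm.
  split; first by move=> x0 x1; apply: bob_init_norm.
  split; first by move=> r _; apply: qunitary_id.
  split; first by move=> r _; apply: qunitary_bob.
  split; split.
  - case=> [y|]/= v; first exact: psdD.
    by rewrite qform_dot qdot0r// => i; rewrite /qapply big1// => j _; rewrite mul0r.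
  - move=> i j; rewrite (bigD1 None)//= add0r -sumD.
    rewrite (reindex_omap Some id) => [|[y|]]//.
    by apply: eq_bigl => y; rewrite eqxx.
  - case=> v /=; first by rewrite (qform_id qid)// qdot_ge0.
    by rewrite qform_dot qdot0r// => i; rewrite /qapply big1// => j _; rewrite mul0r.
  - by move=> i j; rewrite big_bool /= addr0.
move=> a x0 x1; rewrite /honest_state /= qjoint_run -[RHS]setting_prob_sum.
apply: eq_bigr => t _; apply: eq_bigr => y _.
rewrite (eq_qform _ (tw (x0, x1, (t, y)) (alice_init p a)) _ _
                    (tw (x0, x1, (t, y)) (alice_init p a))).
- by rewrite (hD a (x0, x1, (t, y))) mulr1.
- by move=> i; rewrite /twist qapply_id.
- by move=> i; rewrite /twist qapply_id.
Qed.

Lemma protocol_alice D : PAlice_le (protocol p delta D) ((1 + p) / 2 + delta).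
Proof.
move=> c [k psi U E] /= [/= psi1 [uU povmE]].
rewrite /alice_certain /alice_success /alice_state /= => cert.
pose phi := qapply (U 0%N) psi.
have phi1 : qdot phi phi = 1 by rewrite /phi qunitary_dot; [exact: psi1 | exact: uU].
under eq_bigr => x0 _ do under eq_bigr => x1 _ do under eq_bigr => g _ do rewrite qjoint_run.
have -> : \sum_x0 \sum_x1 \sum_(g | sel (~~ c) g.1 g.2 == sel (~~ c) x0 x1)
    \sum_t \sum_y (setting_prob delta t)%:C *
      qform (tw (x0, x1, (t, y)) phi) (E g) (tw (x0, x1, (t, y)) phi) =
  \sum_x0 \sum_x1 \sum_t \sum_y (setting_prob delta t)%:C *
    \sum_(g | sel (~~ c) g.1 g.2 == sel (~~ c) x0 x1)
      qform (tw (x0, x1, (t, y)) phi) (E g) (tw (x0, x1, (t, y)) phi).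
  apply: eq_bigr => x0 _; apply: eq_bigr => x1 _.
  rewrite exchange_big; apply: eq_bigr => t _.
  by rewrite exchange_big; apply: eq_bigr => y _; rewrite mulr_sumr.
apply: guess_success => //= -[[x0 x1] [t y]] /=.
have := cert x0 x1.
under eq_bigr => g _ do rewrite big_bool /= qjoint_zero addr0 qjoint_run.
pose q t y := \sum_(g | sel c g.1 g.2 == sel c x0 x1)
  qform (tw (x0, x1, (t, y)) phi) (E g) (tw (x0, x1, (t, y)) phi).
rewrite exchange_big /=.
under eq_bigr => t' _ do rewrite exchange_big /=.
under eq_bigr => t' _ do under eq_bigr => y' _ do rewrite -mulr_sumr -/(q t' y').
(* An average with positive weights of numbers at most 1 equals 1 only if each of them does:
   certainty on average is certainty in every setting. *)
have q1 t' y' : q t' y' <= 1.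
  by rewrite -(twist_norm p p_ge0 p_le1 phi phi1 (x0, x1, (t', y'))) qpovm_le1.
rewrite -[X in _ = X]setting_prob_sum => /esym/eqP.
rewrite -subr_eq0 -sumrB psumr_eq0 => [/allP/(_ t (mem_index_enum t))|t' _]; last first.
  rewrite -sumrB sumr_ge0// => y' _.
  by rewrite -[X in X - _]mulr1 -mulrBr mulr_ge0 ?subr_ge0// ler0c ltW ?setting_prob_gt0.
rewrite /= -sumrB psumr_eq0 => [/allP/(_ y (mem_index_enum y))|y' _]; last first.
  by rewrite -[X in X - _]mulr1 -mulrBr mulr_ge0 ?subr_ge0// ler0c ltW ?setting_prob_gt0.
rewrite /= -[X in X - _]mulr1 -mulrBr mulf_eq0 subr_eq0 => /orP[|/eqP/esym]//.
have := setting_prob_gt0 delta delta_gt0 delta_lt1 t.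
by rewrite -ltcR lt0r => /andP[/negPf ->].
Qed.

(** For each message Bob's two guesses have total probability 1, so he succeeds with at most half
    the sum over messages of the larger weight: three messages with [(1 - p) / 2] and two with
    [p / 2]. *)
Lemma protocol_bob D : qpovm D -> PBob_le (protocol p delta D) ((3 - p) / 4).
Proof.
move=> [_ sumD] [k beta V F] /= [/= beta1 [uV povmF]].
rewrite /bob_success /=.
have uV0 := uV 0%N isT.
pose P a m := guess_prob (V 0) beta (F a) (enum_rank (m, (false, false, false)) : MT).
have run a : \sum_(y : bool) qjoint (D y) (F a)
    (qapply (liftB (V 0)) (qapply (liftA qid) (qprod (alice_init p a) beta))) =
    \sum_m (weight p a m)%:C * P a m.
  rewrite qjoint_sum (qjoint_message _ _ _ _ _ (alice_amp p a) alice_message) //.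
  exact: (alice_amp_sum p p_ge0 p_le1 a (P a)).
under eq_bigr => a _ do rewrite run.
pose wmax (m : message) : R := if m is inr _ then p / 2 else (1 - p) / 2.
have wle a m : weight p a m <= wmax m.
  case: m => [[y|]|y] //=; case: ifP => // _.
  by rewrite divr_ge0 ?subr_ge0.
apply: (@le_trans _ _ (2%:R^-1 * \sum_m (wmax m)%:C)).
  rewrite ler_wpM2l ?invr_ge0 ?ler0n// exchange_big; apply: ler_sum => m _.
  rewrite -[leRHS]mulr1 -(guess_prob_sum (V 0) beta F
    (enum_rank (m, (false, false, false)) : MT) uV0 beta1 povmF) mulr_sumr.
  apply: ler_sum => a _; rewrite ler_wpM2r ?lecR//.
  by apply: guess_prob_ge0; apply: povmF.1.
rewrite -(rmorph_nat (real_complex R)) -fmorphV -rmorph_sum -rmorphM lecR.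
rewrite sum_message !big_bool /=; lra.
Qed.

End Main.

Theorem theorem2 (R : realType) (a b : R) :
  2^-1 <= a <= 1 -> 2^-1 <= b <= 1 -> 2 * b + a = 2 ->
  forall eps : R, 0 < eps ->
  exists P : ot_protocol R,
    ot_protocol_ok P /\
    PAlice_le P (a + eps / 2) /\ PBob_le P (b + eps / 4).
Proof.
move=> /andP[a_ge a_le] _ hab eps eps0.
(* With this [p] one has [(1 + p) / 2 = a] and [(3 - p) / 4 = b]. The cap on [delta] keeps it below
   1 for large [eps]. *)
pose p := 2 * a - 1; pose delta := Num.min (eps / 2) 2^-1.
have p0 : 0 <= p by rewrite /p; lra.
have p1 : p <= 1 by rewrite /p; lra.
have d0 : 0 < delta by rewrite lt_min divr_gt0 //= invr_gt0 ltr0n.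
have d1 : delta < 1 by rewrite gt_min; apply/orP; right; lra.
have d_eps : delta <= eps / 2 by rewrite ge_min lexx.
(* The family ranges over all choices and settings and is labelled by the bit to be decoded, so a
   single measurement [D] is correct in every case. *)
pose u (j : bool * setting) := twist (bob_phase p) bob_act j.2 (alice_init p j.1).
have orth (j k : bool * setting) : sel j.1 j.2.1.1 j.2.1.2 != sel k.1 k.2.1.1 k.2.1.2 ->
    qdot (u j) (u k) = 0 by exact: honest_orth.
have [D [povmD hD]] := perfect_discrimination u (fun j => sel j.1 j.2.1.1 j.2.1.2) orth.
exists (protocol p delta D); split; last split.
- apply: protocol_ok => // c d; rewrite (hD (c, d)) dot_twist ?honest_norm//.
    exact: bob_phase_norm.
  exact: bob_actK.
- move=> c S okS certS; apply: le_trans (protocol_alice p delta p0 p1 d0 d1 D c S okS certS) _.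
  by rewrite lecR /p; lra.
- move=> S okS; apply: le_trans (protocol_bob p delta p0 p1 D povmD S okS) _.
  by rewrite lecR /p; lra.
Qed.
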